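(* Let $\{A,B,C\}\subset S^{1,1}$ be a non-degenerate contractible spatiolateral de Sitter triangle with polar triangle $\{A',B',C'\}$, the vertices being named in such a way that the side $a'$ of the polar triangle (between $B'$ and $C'$) is not strange, i.e. $B'$ and $C'$ both lie in $H^2$ or both lie in $-H^2$. Let $a,b,c$ be the side lengths opposite $A,B,C$ and $\alpha,\beta,\gamma$ the angles at $A,B,C$. Then $$\cos(a)=\cos(b)\cos(c)-\cosh(\alpha)\sin(b)\sin(c),$$ $$\cos(b)=\cos(a)\cos(c)+\cosh(\beta)\sin(a)\sin(c),$$ $$\cos(c)=\cos(a)\cos(b)+\cosh(\gamma)\sin(a)\sin(b).$$
   Context: On $\mathbb{R}^3$ let $\langle\langle x,y\rangle\rangle=-x_1y_1+x_2y_2+x_3y_3$, $|||x|||=\sqrt{|\langle\langle x,x\rangle\rangle|}$, and let $\times$ be the Euclidean cross product. $S^{1,1}=\{x:\langle\langle x,x\rangle\rangle=1\}$, $H^2=\{x:\langle\langle x,x\rangle\rangle=-1,\ x_1>0\}$, $-H^2=\{-x:x\in H^2\}$. A two-dimensional linear subspace is spacelike if $\langle\langle\cdot,\cdot\rangle\rangle$ restricted to it is positive definite. For $A,B\in S^{1,1}$ with $A\ne\pm B$, the side between $A$ and $B$ is spacelike if $\operatorname{span}(A,B)$ is spacelike (equivalently $|\langle\langle A,B\rangle\rangle|<1$); its length is then $\arccos(\langle\langle A,B\rangle\rangle)\in(0,\pi)$, and the unit tangent vector at $A$ towards $B$ is $X_{AB}=\dfrac{B-\langle\langle A,B\rangle\rangle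 A}{|||A\times B|||}$. A spatiolateral triangle is a set of three distinct points $\{A,B,C\}\subset S^{1,1}$ all of whose sides are spacelike; it is non-degenerate if $A,B,C$ are linearly independent. It is contractible if, after projecting the vertices to the $(x_2,x_3)$-plane, there is a line through the origin such that all three projected points lie on one side of the line. Side lengths: $a$ between $B$ and $C$, $b$ between $A$ and $C$, $c$ between $A$ and $B$. The angle at $A$ is $\alpha=\operatorname{arcosh}(|\langle\langle X_{AB},X_{AC}\rangle\rangle|)\ge 0$, and analogously $\beta$ at $B$, $\gamma$ at $C$. The polar triangle $\{A',B',C'\}$ is given by $A'=\epsilon\frac{B\times C}{|||B\times C|||}$, $B'=\epsilon\frac{C\times A}{|||C\times A|||}$, $C'=\epsilon\frac{A\times B}{|||A\times B|||}$ with $\epsilon=\operatorname{sign}\det(A,B,C)$. The polar triangle of a non-degenerate spatiolateral triangle is contained in $H^2\cup(-H^2)$. *)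

(* Defs.v *)
From mathcomp Require Import all_boot all_order all_algebra.
From mathcomp Require Import all_classical all_reals all_analysis.

Set Implicit Arguments.
Unset Strict Implicit.
Unset Printing Implicit Defensive.

Import Order.TTheory GRing.Theory Num.Theory.
Import numFieldNormedType.Exports.

Local Open Scope classical_set_scope.
Local Open Scope ring_scope.

(* Vectors of R^3 are row vectors; the coordinates x_1, x_2, x_3 of x are
   x 0 0, x 0 1, x 0 2. *)

Definition cosh {R : realType} (x : R) : R := (expR x + expR (- x)) / 2.

(* The inverse of cosh on [0, +oo[, set up like acos in trigo.v; the value is
   irrelevant for x < 1. *)
Definition arcosh {R : realType} (x : R) : R :=
  get [set y : R | 0 <= y /\ cosh y = x].

Definition mink {R : realType} (x y : 'rV[R]_3) : R :=
  - (x 0 0 * y 0 0) + x 0 1 * y 0 1 + x 0 2 * y 0 2.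

Definition mnorm {R : realType} (x : 'rV[R]_3) : R := Num.sqrt `|mink x x|.

Definition cross {R : realType} (x y : 'rV[R]_3) : 'rV[R]_3 :=
  \row_(j < 3) nth 0 [:: x 0 1 * y 0 2 - x 0 2 * y 0 1;
                         x 0 2 * y 0 0 - x 0 0 * y 0 2;
                         x 0 0 * y 0 1 - x 0 1 * y 0 0] j.

Definition det3 {R : realType} (A B C : 'rV[R]_3) : R :=
  \det (\matrix_(i < 3) nth 0 [:: A; B; C] i).

Definition S11 {R : realType} : set 'rV[R]_3 := [set x | mink x x = 1].

Definition H2 {R : realType} : set 'rV[R]_3 :=
  [set x | mink x x = -1 /\ 0 < x 0 0].

Definition negH2 {R : realType} : set 'rV[R]_3 := [set - x | x in H2].

Definition spacelike_plane {R : realType} (U : {vspace 'rV[R]_3}) : Prop :=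
  \dim U = 2%N /\ forall x, x \in U -> x != 0 -> 0 < mink x x.

Definition spacelike_side {R : realType} (A B : 'rV[R]_3) : Prop :=
  [/\ A != B, A != - B & spacelike_plane <<[:: A; B]>>%VS].

Definition spatiolateral {R : realType} (A B C : 'rV[R]_3) : Prop :=
  [/\ S11 A, S11 B & S11 C] /\
  [/\ A != B, B != C & A != C] /\
  [/\ spacelike_side A B, spacelike_side B C & spacelike_side A C].

Definition nondegenerate_triangle {R : realType} (A B C : 'rV[R]_3) : Prop :=
  free [:: A; B; C].

Definition proj23 {R : realType} (x : 'rV[R]_3) : 'rV[R]_2 :=
  \row_(j < 2) nth 0 [:: x 0 1; x 0 2] j.

(* n is a Euclidean normal of the line, so the line is {p | n.p = 0} and
   {p | n.p > 0} is one of its sides (the other one is obtained from -n).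
   Closed sides would give the same notion for spatiolateral triangles: no
   projected vertex is 0, and if two of them were opposite in direction, the
   corresponding vertices A, B would satisfy <<A,B>> <= -1. *)
Definition contractible_triangle {R : realType} (A B C : 'rV[R]_3) : Prop :=
  exists2 n : 'rV[R]_2, n != 0 &
    forall P, P \in [:: A; B; C] -> 0 < (n *m (proj23 P)^T) 0 0.

Definition side_length {R : realType} (A B : 'rV[R]_3) : R := acos (mink A B).

Definition tangent {R : realType} (A B : 'rV[R]_3) : 'rV[R]_3 :=
  (mnorm (cross A B))^-1 *: (B - mink A B *: A).

(* The angle at A of the triangle {A, B, C}. *)
Definition vertex_angle {R : realType} (A B C : 'rV[R]_3) : R :=
  arcosh `|mink (tangent A B) (tangent A C)|.

Definition polar_triangle {R : realType} (A B C : 'rV[R]_3) :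
    'rV[R]_3 * 'rV[R]_3 * 'rV[R]_3 :=
  let vertex X Y :=
    Num.sg (det3 A B C) *: ((mnorm (cross X Y))^-1 *: cross X Y) in
  (vertex B C, vertex C A, vertex A B).

Definition not_strange {R : realType} (X Y : 'rV[R]_3) : Prop :=
  (H2 X /\ H2 Y) \/ (negH2 X /\ negH2 Y).

(* Main.v *)
(** The Euclidean cross product satisfies
    <<A x B, C x D>> = <<A, D>> <<B, C>> - <<A, C>> <<B, D>>,
    so the sides being spacelike makes the three cross products timelike, and
    each formula holds up to the sign of <<B, C>> - <<A, C>> <<A, B>> =
    <<C x A, A x B>> and its analogues.  For timelike vectors that sign is
    decided by the sheets they lie on, that is, by the signs of their first
    coordinates.  That a' is not strange puts C x A and A x B on the same
    sheet.  The first coordinates of B x C, C x A, A x B are the coefficients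
    of a linear relation between the projections of A, B, C to the
    (x_2, x_3)-plane; contractibility forbids them all to have the same sign,
    so B x C lies on the opposite sheet. *)
Require Import Defs.
From mathcomp Require Import all_boot all_order all_algebra.
From mathcomp Require Import all_classical all_reals all_analysis.
From mathcomp Require Import ring lra.

Set Implicit Arguments.
Unset Strict Implicit.
Unset Printing Implicit Defensive.

Import Order.TTheory GRing.Theory Num.Theory.
Import numFieldNormedType.Exports.

Local Open Scope ring_scope.

Section DeSitterTriangles.
Variable R : realType.
Implicit Types A B C D P Q : 'rV[R]_3.

(** Since [arcosh] is chosen by [get], exhibiting one nonnegative preimage is enough. It is
    [ln (x + s)] with [s] the root of [x ^+ 2 - 1], because [x + s] and [x - s] are mutually
    inverse. *)
Lemma cosh_arcosh (x : R) : 1 <= x -> cosh (arcosh x) = x.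
Proof.
move=> x1; rewrite /arcosh; case: (getPex (P := [set y | 0 <= y /\ cosh y = x])) => //.
have s0 : 0 <= x ^+ 2 - 1 by nra.
set s := Num.sqrt (x ^+ 2 - 1).
have sE : s ^+ 2 = x ^+ 2 - 1 by rewrite sqr_sqrtr.
have sge0 : 0 <= s by exact: sqrtr_ge0.
have xs1 : 1 <= x + s by lra.
have xs0 : 0 < x + s by lra.
exists (ln (x + s)); split; first exact: ln_ge0.
rewrite /cosh expRN lnK //.
have -> : (x + s)^-1 = x - s.
  apply: (mulfI (lt0r_neq0 xs0)); rewrite divff ?lt0r_neq0 //; nra.
by field.
Qed.

Lemma minkC A B : mink A B = mink B A.
Proof. by rewrite /mink; ring. Qed.

Lemma minkZ (k l : R) A B : mink (k *: A) (l *: B) = k * l * mink A B.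
Proof. by rewrite /mink !mxE; ring. Qed.

Lemma mink_cross A B C D :
  mink (cross A B) (cross C D) = mink A D * mink B C - mink A C * mink B D.
Proof. by rewrite /mink /cross !mxE /=; ring. Qed.

(** This bound puts the argument of [arcosh] in [vertex_angle] in the range where [cosh_arcosh]
    applies. *)
Lemma mink_gram A B C : mink A A = 1 -> mink B B = 1 -> mink C C = 1 ->
  (1 - mink A C ^+ 2) * (1 - mink A B ^+ 2)
    <= (mink B C - mink A C * mink A B) ^+ 2.
Proof.
move=> hA hB hC; rewrite -subr_ge0.
set d := A 0 0 * (cross B C) 0 0 + A 0 1 * (cross B C) 0 1
         + A 0 2 * (cross B C) 0 2.
(* Jacobi's identity for the Gram matrix, of determinant [- d ^+ 2]. *)
suff -> : (mink B C - mink A C * mink A B) ^+ 2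
    - (1 - mink A C ^+ 2) * (1 - mink A B ^+ 2) = d ^+ 2 by exact: sqr_ge0.
have : (mink A A * mink B C - mink A C * mink A B) ^+ 2
    - (mink A A * mink C C - mink A C ^+ 2)
      * (mink A A * mink B B - mink A B ^+ 2) = mink A A * d ^+ 2.
  by rewrite /d /mink /cross !mxE /=; ring.
by rewrite hA hB hC !mul1r.
Qed.

Lemma spacelike_side_lt1 A B : S11 A -> S11 B -> spacelike_side A B ->
  mink A B ^+ 2 < 1.
Proof.
move=> hA hB [nAB nANB [_ pos]]; rewrite /S11 /= in hA hB.
(* [v] is the component of [B] orthogonal to [A]; it vanishes only if [B] is [A] or [- A]. *)
set v := B - mink A B *: A.
have vE : mink v v = 1 - mink A B ^+ 2.
  have -> : mink v v = mink B B - mink A B ^+ 2 * (2 - mink A A).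
    by rewrite /v {1}/mink !mxE /mink; ring.
  by rewrite hA hB; ring.
rewrite -subr_gt0 -vE; apply: pos.
  by rewrite rpredB ?rpredZ // memv_span // !inE eqxx ?orbT.
apply/eqP => v0; have /eqP := vE.
have -> : mink v v = 0 by rewrite v0 /mink !mxE !mul0r oppr0 !addr0.
rewrite eq_sym subr_eq0 eq_sym sqrf_eq1.
move/eqP : v0; rewrite subr_eq0 => /eqP BE.
case/orP => /eqP z; move: BE; rewrite z ?scaleN1r ?scale1r => BE.
  by rewrite BE eqxx in nAB.
by rewrite BE opprK eqxx in nANB.
Qed.

Lemma mnorm_cross A B : S11 A -> S11 B -> mink A B ^+ 2 < 1 ->
  mnorm (cross A B) = Num.sqrt (1 - mink A B ^+ 2).
Proof.
move=> hA hB h; rewrite /S11 /= in hA hB.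
by rewrite /mnorm mink_cross hA hB (minkC B A) -expr2 mul1r distrC gtr0_norm // subr_gt0.
Qed.

Lemma sqr_lt1_itv (x : R) : x ^+ 2 < 1 -> -1 <= x <= 1.
Proof. by move=> h; apply/andP; split; nra. Qed.

Lemma cos_side_length A B : mink A B ^+ 2 < 1 -> cos (side_length A B) = mink A B.
Proof. by move=> h; rewrite /side_length acosK // in_itv /= sqr_lt1_itv. Qed.

Lemma sin_side_length A B : mink A B ^+ 2 < 1 ->
  sin (side_length A B) = Num.sqrt (1 - mink A B ^+ 2).
Proof. by move=> h; rewrite /side_length sin_acos // sqr_lt1_itv. Qed.

(** The sines of the two sides are the norms by which the tangent vectors at [A] are divided, so
    they cancel. *)
Lemma cosh_vertex_angle A B C : S11 A -> S11 B -> S11 C ->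
    mink A B ^+ 2 < 1 -> mink A C ^+ 2 < 1 ->
  cosh (vertex_angle A B C) * sin (side_length A C) * sin (side_length A B)
    = `|mink B C - mink A C * mink A B|.
Proof.
move=> hA hB hC hAB hAC.
rewrite !sin_side_length // /vertex_angle /tangent minkZ !mnorm_cross //.
have -> : mink (B - mink A B *: A) (C - mink A C *: A)
    = mink B C - mink A C * mink A B.
  rewrite /S11 /= in hA.
  have -> : mink (B - mink A B *: A) (C - mink A C *: A)
      = mink B C - mink A C * mink A B * (2 - mink A A).
    by rewrite {1}/mink !mxE /mink; ring.
  by rewrite hA; ring.
have := mink_gram hA hB hC.
set u := mink B C - _; set s := Num.sqrt (1 - mink A B ^+ 2).
set t := Num.sqrt (1 - mink A C ^+ 2) => gram.
have s0 : 0 < s by rewrite sqrtr_gt0 subr_gt0.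
have t0 : 0 < t by rewrite sqrtr_gt0 subr_gt0.
have st : t * s <= `|u|.
  rewrite -(@ler_pXn2r _ 2) ?nnegrE ?normr_ge0 ?mulr_ge0 ?(ltW s0) ?(ltW t0) //.
  by rewrite real_normK ?num_real // exprMn !sqr_sqrtr // ltW // subr_gt0.
rewrite normrM (@gtr0_norm _ (s^-1 * t^-1)) ?mulr_gt0 ?invr_gt0 //.
rewrite cosh_arcosh.
  by field; rewrite !lt0r_neq0.
by rewrite mulrC -invfM (mulrC s) ler_pdivlMr ?mul1r ?mulr_gt0.
Qed.

Lemma timelike_mink_sign P Q : mink P P < 0 -> mink Q Q < 0 ->
  0 < P 0 0 * Q 0 0 -> mink P Q < 0.
Proof.
rewrite /mink; move: (P 0 0) (P 0 1) (P 0 2) (Q 0 0) (Q 0 1) (Q 0 2).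
move=> p0 p1 p2 q0 q1 q2 hP hQ pq.
(* Cauchy-Schwarz in the (x_2, x_3)-plane. *)
have cs : (p1 * q1 + p2 * q2) ^+ 2 <= (p1 ^+ 2 + p2 ^+ 2) * (q1 ^+ 2 + q2 ^+ 2).
  by have := sqr_ge0 (p1 * q2 - p2 * q1); nra.
(* Multiply the two timelike conditions. *)
have lt : (p1 ^+ 2 + p2 ^+ 2) * (q1 ^+ 2 + q2 ^+ 2) < p0 ^+ 2 * q0 ^+ 2.
  by apply: ltr_pM; nra.
have : (p1 * q1 + p2 * q2) ^+ 2 < (p0 * q0) ^+ 2.
  by rewrite exprMn; exact: le_lt_trans cs lt.
nra.
Qed.

Lemma timelike_mink_opposite P Q : mink P P < 0 -> mink Q Q < 0 ->
  P 0 0 * Q 0 0 < 0 -> 0 < mink P Q.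
Proof.
move=> hP hQ pq.
have NE : mink (- P) Q = - mink P Q by rewrite /mink !mxE; ring.
rewrite -oppr_lt0 -NE; apply: timelike_mink_sign => //.
  by move: hP; rewrite /mink !mxE !mulrNN.
by rewrite mxE mulNr oppr_gt0.
Qed.

Lemma cross_timelike A B : S11 A -> S11 B -> mink A B ^+ 2 < 1 ->
  mink (cross A B) (cross A B) < 0.
Proof.
move=> hA hB h; rewrite /S11 /= in hA hB.
by rewrite mink_cross hA hB (minkC B A) -expr2 mul1r subr_lt0.
Qed.

Lemma not_strange_sheet P Q : not_strange P Q -> 0 < P 0 0 * Q 0 0.
Proof.
case=> [[[_ p] [_ q]]|[[P1 [_ p] <-] [Q1 [_ q] <-]]]; first exact: mulr_gt0.
by rewrite !mxE mulrNN mulr_gt0.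
Qed.

(** Pair the Cramer relation between the three projections with the normal [n]: the weights [p],
    [q], [r] are the values of [n] on the projected vertices. *)
Lemma contractible_normal A B C : contractible_triangle A B C ->
  exists p q r : R, [/\ 0 < p, 0 < q, 0 < r &
    p * (cross B C) 0 0 + q * (cross C A) 0 0 + r * (cross A B) 0 0 = 0].
Proof.
case=> n _ h; exists ((n *m (proj23 A)^T) 0 0), ((n *m (proj23 B)^T) 0 0),
  ((n *m (proj23 C)^T) 0 0); split; try by apply: h; rewrite !inE eqxx ?orbT.
by rewrite !mxE !big_ord_recl !big_ord0 /proj23 /cross !mxE /=; ring.
Qed.

End DeSitterTriangles.

Theorem theorem5p3 (R : realType) (A B C A' B' C' : 'rV[R]_3)
    (hABC : spatiolateral A B C)
    (hnd : nondegenerate_triangle A B C)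
    (hcontr : contractible_triangle A B C)
    (hpolar : polar_triangle A B C = (A', B', C'))
    (ha' : not_strange B' C')
    (a b c alpha beta gamma : R)
    (ha : a = side_length B C)
    (hb : b = side_length A C)
    (hc : c = side_length A B)
    (halpha : alpha = vertex_angle A B C)
    (hbeta : beta = vertex_angle B A C)
    (hgamma : gamma = vertex_angle C A B) :
  [/\ cos a = cos b * cos c - cosh alpha * sin b * sin c,
      cos b = cos a * cos c + cosh beta * sin a * sin c
    & cos c = cos a * cos b + cosh gamma * sin a * sin b].
Proof.
have [[hA hB hC] [_ [sAB sBC sAC]]] := hABC.
have lAB := spacelike_side_lt1 hA hB sAB.
have lBC := spacelike_side_lt1 hB hC sBC.
have lAC := spacelike_side_lt1 hA hC sAC.
have lBA : mink B A ^+ 2 < 1 by rewrite minkC.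
have lCA : mink C A ^+ 2 < 1 by rewrite minkC.
have lCB : mink C B ^+ 2 < 1 by rewrite minkC.
have tAB := cross_timelike hA hB lAB.
have tBC := cross_timelike hB hC lBC.
have tCA := cross_timelike hC hA lCA.
have D23 : 0 < (cross C A) 0 0 * (cross A B) 0 0.
  have := not_strange_sheet ha'; case: hpolar => _ <- <-.
  rewrite !mxE /=.
  set e := Num.sg _; set s := (mnorm _)^-1; set t := (mnorm (cross A B))^-1.
  have s0 : 0 <= s by rewrite invr_ge0 sqrtr_ge0.
  have t0 : 0 <= t by rewrite invr_ge0 sqrtr_ge0.
  set p := (X in e * (s * X)); set q := (X in _ * (e * (t * X))).
  (* The common sign [e] enters squared, so normalising the polar vertices cannot reverse the sign
     of [p * q]. *)
  have -> : e * (s * p) * (e * (t * q)) = e ^+ 2 * s * t * (p * q) by ring.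
  apply: contraTT; rewrite -!leNgt => pq.
  by rewrite mulr_ge0_le0 // (mulr_ge0 (mulr_ge0 (sqr_ge0 e) s0)).
have [p [q [r [p0 q0 r0 rel]]]] := contractible_normal hcontr.
(* Multiply [rel] by the first coordinate of [cross A B]: the last two terms are then positive and
   nonnegative. *)
have D13 : (cross B C) 0 0 * (cross A B) 0 0 < 0.
  have : p * ((cross B C) 0 0 * (cross A B) 0 0) < 0.
    have -> : p * ((cross B C) 0 0 * (cross A B) 0 0) =
        - (q * ((cross C A) 0 0 * (cross A B) 0 0) + r * (cross A B) 0 0 ^+ 2).
      by apply/eqP; rewrite -addr_eq0 -(mul0r ((cross A B) 0 0)) -rel; apply/eqP; ring.
    by rewrite oppr_lt0 (ltr_pwDl (mulr_gt0 q0 D23)) // (mulr_ge0 (ltW r0)) ?sqr_ge0.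
  by rewrite pmulr_rlt0.
have D12 : (cross B C) 0 0 * (cross C A) 0 0 < 0.
  move: D13 D23.
  move: ((cross B C) 0 0) ((cross C A) 0 0) ((cross A B) 0 0) => x y z xz yz.
  have : x * y * z ^+ 2 < 0 by nra.
  by rewrite pmulr_llt0 // lt0r sqr_ge0 sqrf_eq0 andbT; apply: contraTneq yz => ->;
    rewrite mulr0 ltxx.
have u := timelike_mink_sign tCA tAB D23.
have v := timelike_mink_opposite tBC tAB D13.
have w := timelike_mink_opposite tBC tCA D12.
rewrite /S11 /= in hA hB hC.
(* Now [u], [v], [w] give the signs of the expressions inside the absolute values that
   [cosh_vertex_angle] produces at [A], [B], [C]. *)
rewrite !mink_cross ?hA ?hB ?hC (minkC C A) (minkC C B) (minkC B A) in u v w.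
subst; rewrite !cos_side_length //.
have sE P Q : side_length P Q = side_length Q P :> R by rewrite /side_length minkC.
split.
- rewrite cosh_vertex_angle // ltr0_norm; first by ring.
  by lra.
- rewrite (sE A B) cosh_vertex_angle // (minkC B A) gtr0_norm; first by ring.
  by lra.
- rewrite (sE A C) (sE B C) cosh_vertex_angle // (minkC C A) (minkC C B).
  by rewrite gtr0_norm; [ring | lra].
Qed.
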